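(* Let $t\in\mathbb{R}$ and $h\in\mathbb{H}_t$. The operator $M_h$ is a unitary in $\mathcal{M}_t$ (i.e. $M_h^{*}M_h=1_t=M_hM_h^{*}$) if and only if $$\|h\|_t^2=\langle h,h\rangle_t=\tau(h\cdot_t h^{\dagger})=\det([h]_t)=1.$$
   Context: For $t\in\mathbb{R}$, the $t$-scaled hypercomplex ring $\mathbb{H}_t$ is the set $\mathbb{C}^2$ with the usual vector addition and the multiplication $(a_1,b_1)\cdot_t(a_2,b_2)=(a_1a_2+t\,b_1\overline{b_2},\;a_1b_2+b_1\overline{a_2})$, regarded also as a vector space over $\mathbb{R}$. Set $(a,b)^{\dagger}=(\overline{a},-b)$, $[(a,b)]_t=\begin{pmatrix}a & tb\\ \overline{b} & \overline{a}\end{pmatrix}\in M_2(\mathbb{C})$, $\tau((a,b))=\mathrm{Re}(a)$, $\langle h_1,h_2\rangle_t=\tau(h_1\cdot_t h_2^{\dagger})\in\mathbb{R}$, and $\|h\|_t=\sqrt{|\langle h,h\rangle_t|}$. For $\eta\in\mathbb{H}_t$, $M_\eta:\mathbb{H}_t\to\mathbb{H}_t$ is the $\mathbb{R}$-linear multiplication operator $M_\eta(h)=\eta\cdot_t h$. The hypercomplex algebra over $\mathbb{R}$ is $\mathcal{M}_t=\{M_\eta:\eta\in\mathbb{H}_t\}$, with operator addition and composition, with adjoint $M_\eta^{*}=M_{\eta^{\dagger}}$ and identity $1_t=M_{(1,0)}$. *)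

(* Defs.v *)
From HB Require Import structures.
From mathcomp Require Import all_boot all_order all_algebra.
From mathcomp Require Import ring.
From mathcomp Require Import complex.
From mathcomp Require Import classical_sets reals.

Set Implicit Arguments.
Unset Strict Implicit.
Unset Printing Implicit Defensive.

Import Order.TTheory GRing.Theory Num.Theory.
Local Open Scope ring_scope.
Local Open Scope complex_scope.

(* An alias of C^2, tagged by the scale t: it keeps the additive group of the
   pair type but not its componentwise product. *)
Definition hyper (R : realType) (t : R) : Type := (R[i] * R[i])%type.

Definition Hyper (R : realType) (t : R) (a b : R[i]) : hyper t := (a, b).

Section HyperStructures.
Variables (R : realType) (t : R).
Implicit Types (g h : hyper t) (r : R).

HB.instance Definition _ :=
  GRing.Zmodule.copy (hyper t) (R[i] * R[i])%type.

Definition hmul g h : hyper t :=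
  (g.1 * h.1 + t%:C * (g.2 * conjc h.2), g.1 * h.2 + g.2 * conjc h.1).

Fact conjc_realC r : conjc r%:C = r%:C :> R[i].
Proof. by rewrite /= oppr0. Qed.

Fact conjcD (x y : R[i]) : conjc (x + y) = conjc x + conjc y.
Proof. exact: (rmorphD (@conjc R)). Qed.

Fact conjcM (x y : R[i]) : conjc (x * y) = conjc x * conjc y.
Proof. exact: (rmorphM (@conjc R)). Qed.

Fact hmulA : associative hmul.
Proof.
move=> [a1 b1] [a2 b2] [a3 b3]; rewrite /hmul /=; congr (_, _);
  rewrite !(conjcD, conjcM) ?conjc_realC ?conjcK; ring.
Qed.

Fact hmul1l : left_id (Hyper t 1 0) hmul.
Proof.
by move=> [a b]; rewrite /hmul /= !mul1r !mul0r mulr0 !addr0.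
Qed.

Fact hmul1r : right_id (Hyper t 1 0) hmul.
Proof.
by move=> [a b]; rewrite /hmul /= oppr0 !mulr1 !mulr0 addr0 add0r.
Qed.

Fact hmulDl : left_distributive hmul +%R.
Proof.
move=> [a1 b1] [a2 b2] [a3 b3].
by rewrite /hmul /=; congr (_, _) => /=; ring.
Qed.

Fact hmulDr : right_distributive hmul +%R.
Proof.
move=> [a1 b1] [a2 b2] [a3 b3].
by rewrite /hmul /=; congr (_, _); rewrite /= conjcD; ring.
Qed.

Fact hyper1_neq0 : Hyper t 1 0 != 0.
Proof. by apply/eqP => -[] /eqP; rewrite oner_eq0. Qed.

HB.instance Definition _ := GRing.Zmodule_isNzRing.Build (hyper t)
  hmulA hmul1l hmul1r hmulDl hmulDr hyper1_neq0.

Definition hscale r h : hyper t := (r%:C * h.1, r%:C * h.2).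

Fact hscaleA r s h : hscale r (hscale s h) = hscale (r * s) h.
Proof. by rewrite /hscale /= !mulrA -rmorphM. Qed.

Fact hscale1 : left_id 1 hscale.
Proof. by move=> [a b]; rewrite /hscale /= rmorph1 !mul1r. Qed.

Fact hscaleDr : right_distributive hscale +%R.
Proof. by move=> r [a b] [c d]; rewrite /hscale /= !mulrDr. Qed.

Fact hscaleDl h : {morph hscale^~ h : r s / r + s}.
Proof. by move=> r s; rewrite /hscale rmorphD !mulrDl. Qed.

HB.instance Definition _ := GRing.Zmodule_isLmodule.Build R (hyper t)
  hscaleA hscale1 hscaleDr hscaleDl.

Definition hyper_coord h : 'rV[R]_4 :=
  \row_i [:: complex.Re h.1; complex.Im h.1; complex.Re h.2; complex.Im h.2]`_i.

Fact hyper_vect_iso : Vector.axiom 4 (hyper t).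
Proof.
exists hyper_coord.
  move=> r [[a1 a2] [b1 b2]] [[c1 c2] [d1 d2]]; apply/rowP => i; rewrite !mxE.
  by case: i => [[|[|[|[|i]]]] lti] //=; ring.
exists (fun v : 'rV[R]_4 =>
  Hyper t (v 0 0 +i* v 0 (inord 1)) (v 0 (inord 2) +i* v 0 (inord 3))).
  by move=> [[a1 a2] [b1 b2]]; rewrite /Hyper !mxE /= !inordK.
move=> v; apply/rowP => i; rewrite mxE.
case: i => [[|[|[|[|i]]]] lti] //=; congr (v 0 _); apply: val_inj => //=;
  by rewrite inordK.
Qed.

HB.instance Definition _ := Lmodule_hasFinDim.Build R (hyper t) hyper_vect_iso.

Fact hmul_is_linear (eta : hyper t) : linear ( *%R eta : hyper t -> hyper t).
Proof.
case: eta => [a b] r [c d] [c' d']; rewrite mulrDr; congr (_ + _).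
congr (_, _); rewrite /= conjcM conjc_realC; ring.
Qed.

End HyperStructures.

Section HyperOperators.
Variables (R : realType) (t : R).
Implicit Types (g h eta : hyper t) (T : 'End(hyper t)).

Definition hdag h : hyper t := (conjc h.1, - h.2).

Definition hmx h : 'M[R[i]]_2 :=
  \matrix_(i < 2, j < 2)
    if i == 0 then (if j == 0 then h.1 else t%:C * h.2)
    else (if j == 0 then conjc h.2 else conjc h.1).

Definition htau h : R := complex.Re h.1.

Definition hform g h : R := htau (g * hdag h).

Definition hnorm h : R := Num.sqrt `|hform h h|.

Definition mulop eta : 'End(hyper t) := linfun ( *%R eta : hyper t -> hyper t).

Lemma mulopE eta h : mulop eta h = eta * h.
Proof.
pose L := GRing.isLinear.Build R _ _ _ _ (hmul_is_linear eta).
pose f : {linear hyper t -> hyper t} :=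
  HB.pack ( *%R eta : hyper t -> hyper t) L.
exact: (lfunE f).
Qed.

Definition hyperalg : set 'End(hyper t) := range mulop.

Definition hyperalg1 : 'End(hyper t) := mulop (Hyper t 1 0).

(* The symbol of T in hyperalg is T (1, 0), so that the rule
   M_eta^* = M_(eta^dag) reads as follows on operators; see adjopE. *)
Definition adjop T : 'End(hyper t) := mulop (hdag (T (Hyper t 1 0))).

Lemma adjopE eta : adjop (mulop eta) = mulop (hdag eta).
Proof. by rewrite /adjop mulopE mulr1. Qed.

Definition hunitary T : Prop :=
  [/\ hyperalg T,
      (adjop T \o T)%VF = hyperalg1 & hyperalg1 = (T \o adjop T)%VF].

End HyperOperators.

(* Main.v *)
Require Import Defs.
From mathcomp Require Import all_boot all_order all_algebra.
From mathcomp Require Import ring.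
From mathcomp Require Import complex.
From mathcomp Require Import reals.

Import GRing.Theory Num.Theory.
Local Open Scope ring_scope.
Local Open Scope complex_scope.

(** For h = (a, b) the cross terms of h * hdag h and of hdag h * h cancel, so
    both products equal the real scalar (|a|^2 - t |b|^2, 0)
    ([mulr_hdag], [mulr_hdagl]); this scalar is at once the form <h, h>_t and
    the determinant of [h]_t ([det_hmx]). As eta |-> M_eta is multiplicative
    and injective, each of the two unitarity equations for M_h says that one of
    these products is 1, that is, that <h, h>_t = 1 ([hunitary_mulop]). The
    chain of equalities ending in 1 says the same: its last link is this
    condition, its middle links hold for every h, and its first link
    ||h||_t^2 = <h, h>_t fails exactly when <h, h>_t < 0, so it holds as soon
    as the form is 1. *)

Section HyperUnitary.
Variables (R : realType) (t : R).
Implicit Types (g h : hyper t).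

(** The imaginary part of h.1 * conj h.1 - t * h.2 * conj h.2 vanishes, so
    taking real parts in the form loses nothing. *)
Lemma hformE h :
  (hform h h)%:C = h.1 * conjc h.1 - t%:C * (h.2 * conjc h.2).
Proof.
case: h => [[a1 a2] [b1 b2]]; rewrite /hform /htau /hdag /=; simpc.
by apply/eqP; rewrite eq_complex /=; apply/andP; split; apply/eqP; ring.
Qed.

Lemma mulr_hdag h : h * hdag h = Hyper t (hform h h)%:C 0.
Proof.
rewrite hformE; case: h => [a b]; congr (_, _) => /=.
  by rewrite (rmorphN (@conjc R)) !mulrN.
by rewrite conjcK mulrN mulrC addNr.
Qed.

Lemma mulr_hdagl h : hdag h * h = Hyper t (hform h h)%:C 0.
Proof.
rewrite hformE; case: h => [a b]; congr (_, _) => /=.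
  by rewrite mulNr mulrN mulrC.
by rewrite mulNr mulrC subrr.
Qed.

Lemma det_hmx h : \det (hmx h) = (hform h h)%:C.
Proof. rewrite (expand_det_row _ ord0) !big_ord_recl big_ord0 /cofactor !det_mx11.
by rewrite !mxE /= hformE; ring. Qed.

Lemma mulop_comp g h : (mulop g \o mulop h)%VF = mulop (g * h).
Proof. by apply/lfunP => x; rewrite comp_lfunE !mulopE mulrA. Qed.

(** M_eta determines eta, its value at the unit. *)
Lemma mulop_inj : injective (@mulop R t).
Proof. by move=> g h /lfunP /(_ 1); rewrite !mulopE !mulr1. Qed.

Lemma hunitary_mulop h : hunitary (mulop h) <-> hform h h = 1.
Proof.
rewrite /hunitary adjopE !mulop_comp mulr_hdag mulr_hdagl.
split=> [[_ /mulop_inj [] //]|->].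
by split=> //; exists h.
Qed.

End HyperUnitary.

Theorem theorem5p9 (R : realType) (t : R) (h : hyper t) :
  hunitary (mulop h) <->
  [/\ hnorm h ^+ 2 = hform h h,
      hform h h = htau (h * hdag h),
      (htau (h * hdag h))%:C = \det (hmx h)
    & \det (hmx h) = 1].
Proof.
rewrite det_hmx; split=> [/hunitary_mulop h1|[_ _ _ [h1]]].
  by split=> //; rewrite ?/hnorm h1 // normr1 sqrtr1 expr1n.
exact/hunitary_mulop.
Qed.
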